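(* Let $1\le d\le n$ and $H=\mathrm{Var}(x_1,\ldots,x_d)\subseteq\mathbb{C}^n$. Let $\mathcal L^\bullet$ be a complex of graded $\mathrm{gr}_H^\bullet(D_n)$-modules (i.e. $\mathcal L^i=\bigoplus_{j\in\mathbb{Z}}\mathcal L^i_j$ with $\mathrm{gr}_H^k(D_n)\mathcal L^i_j\subseteq\mathcal L^i_{j+k}$) in which the maps between the $\mathcal L^i$ preserve the grading. Assume that there is a polynomial $b(\theta)\in\mathbb{C}[\theta]$ that satisfies $$b(\theta_d+j)\ker(\mathcal L^i_j\to\mathcal L^{i+1}_j)\subseteq\operatorname{im}(\mathcal L^{i-1}_j\to\mathcal L^i_j)$$ for all $j$ and all $i$. Let $k$ be an integer for which $b(k)\ne0$. Then the complex $\mathcal K^\bullet(\mathcal L^\bullet,x_1,\ldots,x_d)[k]$ is exact.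
   Context: $D_n=\mathbb{C}[x_1,\ldots,x_n]\langle\partial_1,\ldots,\partial_n\rangle$ is the $n$-th Weyl algebra. For a multi-index $\alpha$ put $\alpha_H=(\alpha_1,\ldots,\alpha_d,0,\ldots,0)$. The $V_d$-filtration: $F_H^j(D_n)$ is the $\mathbb{C}$-span of all $x^\alpha\partial^\beta$ with $|\alpha_H|+j\ge|\beta_H|$, and $\mathrm{gr}_H^j(D_n)=F_H^j(D_n)/F_H^{j-1}(D_n)$. As a ring $\mathrm{gr}_H^\bullet(D_n)\cong D_n$, graded so that for $i\le d$ $x_i$ has degree $-1$ and $\partial_i$ has degree $1$, while $x_i,\partial_i$ have degree $0$ for $i>d$. Put $\theta_d=x_1\partial_1+\cdots+x_d\partial_d$ (of degree $0$). Koszul complexes: for a single graded module $\mathcal L$ and $k\in\mathbb{Z}$, $\mathcal K^\bullet(\mathcal L,x_1,\ldots,x_d)[k]$ is the complex $$0\to\mathcal L_{k+d}\otimes_{\mathbb Z}\textstyle\bigwedge^0\mathbb{Z}^d\to\mathcal L_{k+d-1}\otimes_{\mathbb Z}\bigwedge^1\mathbb{Z}^d\to\cdots\to\mathcal L_k\otimes_{\mathbb Z}\bigwedge^d\mathbb{Z}^d\to0$$ with $\delta(u\otimes e_{i_1}\wedge\cdots\wedge e_{i_q})=\sum_lx_lu\otimes e_l\wedge e_{i_1}\wedge\cdots\wedge e_{i_q}$. For a complex $\mathcal L^\bullet$ of graded modules with degree-preserving maps, $\mathcal K^\bullet(\mathcal L^\bullet,x_1,\ldots,x_d)[k]$ is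 defined inductively: for the empty set of variables it is the complex $\cdots\to\mathcal L^i_k\to\mathcal L^{i+1}_k\to\cdots$, and in general it is the total complex of the double complex whose two rows are $\mathcal K^\bullet(\mathcal L^\bullet_{\bullet+1},x_1,\ldots,x_{d-1})[k]$ and $\mathcal K^\bullet(\mathcal L^\bullet_\bullet,x_1,\ldots,x_{d-1})[k]$ (the index $\bullet+1$ meaning that the grading is shifted by one), with vertical maps $(-1)^ix_d$ from the former to the latter. Equivalently, up to signs and indexing, it is the total complex of the double complex with terms $\mathcal L^p_{k+d-q}\otimes_{\mathbb Z}\bigwedge^q\mathbb{Z}^d$, formed from the differential of $\mathcal L^\bullet$ and the Koszul differential $\delta$; it is the graded piece of the usual Koszul complex of $\mathcal L^\bullet$ on $x_1,\ldots,x_d$ that ends in degree $k$. *)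

(* Defs.v *)
From HB Require Import structures.
From mathcomp Require Import all_boot all_order all_algebra.
From mathcomp Require Import finmap generic_quotient ring_quotient.
From mathcomp Require Import boolp classical_sets reals complex.
From mathcomp Require Import monalg mpoly.

Set Implicit Arguments.
Unset Strict Implicit.
Unset Printing Implicit Defensive.

Import Order.TTheory GRing.Theory Num.Theory.

Local Open Scope ring_scope.

(* Laurent polynomials \sum_k a_k t^k with coefficients in A, t central;      *)
(* monalg only provides the product for monoids without nontrivial units.    *)
Definition laurent (A : nzRingType) : Type := {malg A[int]}.

HB.instance Definition _ (A : nzRingType) := GRing.Zmodule.on (laurent A).

Section Laurent.
Variable A : nzRingType.
Implicit Types f g h : laurent A.

Definition lmono (k : int) (a : A) : laurent A := monalg.mkmalgU k a.
Definition lcoef (k : int) (f : laurent A) : A := monalg.mcoeff k f.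

Definition lmul f g : laurent A :=
  \sum_(i <- monalg.msupp f) \sum_(j <- monalg.msupp g)
    lmono (i + j) (lcoef i f * lcoef j g).

Lemma lcoef_is_zmod_morphism k : zmod_morphism (lcoef k).
Proof. by move=> f g; rewrite /lcoef raddfB. Qed.

HB.instance Definition _ k := GRing.isZmodMorphism.Build
  (laurent A) A (lcoef k) (lcoef_is_zmod_morphism k).

Lemma lmono_is_zmod_morphism k : zmod_morphism (lmono k).
Proof. by move=> a b; rewrite /lmono monalgUB. Qed.

HB.instance Definition _ k := GRing.isZmodMorphism.Build
  A (laurent A) (lmono k) (lmono_is_zmod_morphism k).

Lemma lcoef_mono a k l : lcoef l (lmono k a) = a *+ (k == l).
Proof. exact: monalg.mcoeffU. Qed.

Lemma lmulw (d1 d2 : {fset int}) f g :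
  (monalg.msupp f `<=` d1)%fset -> (monalg.msupp g `<=` d2)%fset ->
  lmul f g =
  \sum_(i <- d1) \sum_(j <- d2) lmono (i + j) (lcoef i f * lcoef j g).
Proof.
move=> le1 le2; rewrite /lmul (big_fset_incl _ le1) /=.
  apply/eq_bigr=> k1 _; apply/big_fset_incl => // k _ /monalg.mcoeff_outdom gk.
  by rewrite /lcoef gk mulr0 (raddf0 (lmono _)).
move=> k _ /monalg.mcoeff_outdom fk.
by rewrite big1 // => k' _; rewrite /lcoef fk mul0r (raddf0 (lmono _)).
Qed.

Lemma lmulDl : left_distributive lmul +%R.
Proof.
move=> f g h.
pose d := (monalg.msupp f `|` monalg.msupp g)%fset.
rewrite (@lmulw d (monalg.msupp h) (f + g) h) ?monalg.msuppD_le ?fsubset_refl //.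
rewrite (@lmulw d (monalg.msupp h) f h) ?fsubsetUl ?fsubset_refl //.
rewrite (@lmulw d (monalg.msupp h) g h) ?fsubsetUr ?fsubset_refl //.
rewrite -big_split /=; apply/eq_bigr=> i _.
rewrite -big_split /=; apply/eq_bigr=> j _.
by rewrite (raddfD (lcoef i)) mulrDl (raddfD (lmono _)).
Qed.

Lemma lmulDr : right_distributive lmul +%R.
Proof.
move=> h f g.
pose d := (monalg.msupp f `|` monalg.msupp g)%fset.
rewrite (@lmulw (monalg.msupp h) d h (f + g)) ?monalg.msuppD_le ?fsubset_refl //.
rewrite (@lmulw (monalg.msupp h) d h f) ?fsubsetUl ?fsubset_refl //.
rewrite (@lmulw (monalg.msupp h) d h g) ?fsubsetUr ?fsubset_refl //.
rewrite -big_split /=; apply/eq_bigr=> i _.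
rewrite -big_split /=; apply/eq_bigr=> j _.
by rewrite (raddfD (lcoef j)) mulrDr (raddfD (lmono _)).
Qed.

Lemma lmul0l f : lmul 0 f = 0.
Proof. by apply: (addrI (lmul 0 f)); rewrite -lmulDl !addr0. Qed.

Lemma lmul0r f : lmul f 0 = 0.
Proof. by apply: (addrI (lmul f 0)); rewrite -lmulDr !addr0. Qed.

Lemma lmul_mono a b k l : lmul (lmono k a) (lmono l b) = lmono (k + l) (a * b).
Proof.
rewrite (@lmulw [fset k]%fset [fset l]%fset); try exact: monalg.msuppU_le.
by rewrite !big_seq_fset1 !lcoef_mono !eqxx.
Qed.

Lemma laurentE f : f = \sum_(k <- monalg.msupp f) lmono k (lcoef k f).
Proof. exact: monalgE. Qed.

Lemma laurent_ind (P : laurent A -> Prop) :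
  (forall a k, P (lmono k a)) -> (forall f g, P f -> P g -> P (f + g)) ->
  forall f, P f.
Proof.
move=> Pm Pa f; rewrite [f]laurentE.
have P0 : P 0 by rewrite -(raddf0 (lmono 0)); apply: Pm.
by elim/big_ind: _ => // k _; apply: Pm.
Qed.

Lemma lmulA : associative lmul.
Proof.
move=> f g h; elim/laurent_ind: f => [a k|f1 f2 H1 H2]; last first.
  by rewrite !lmulDl H1 H2.
elim/laurent_ind: g => [b l|g1 g2 H1 H2]; last first.
  by rewrite lmulDl !lmulDr lmulDl H1 H2.
elim/laurent_ind: h => [c m|h1 h2 H1 H2]; last first.
  by rewrite !lmulDr H1 H2.
by rewrite !lmul_mono mulrA addrA.
Qed.

Lemma lmul1l : left_id (lmono 0 1) lmul.
Proof.
move=> f; elim/laurent_ind: f => [a k|f g Hf Hg]; last by rewrite lmulDr Hf Hg.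
by rewrite lmul_mono mul1r add0r.
Qed.

Lemma lmul1r : right_id (lmono 0 1) lmul.
Proof.
move=> f; elim/laurent_ind: f => [a k|f g Hf Hg]; last by rewrite lmulDl Hf Hg.
by rewrite lmul_mono mulr1 addr0.
Qed.

HB.instance Definition _ := GRing.Zmodule_isPzRing.Build (laurent A)
  lmulA lmul1l lmul1r lmulDl lmulDr.

End Laurent.

Record filtration (A : nzRingType) := Filtration {
  fil :> int -> {pred A};
  fil_zmod : forall k, zmod_closed (fil k);
  fil_incl : forall k a, a \in fil (k - 1) -> a \in fil k;
  fil_one : 1 \in fil 0;
  fil_mul : forall k l a b, a \in fil k -> b \in fil l -> a * b \in fil (k + l)
}.

Section AssociatedGraded.
Variables (A : nzRingType) (F : filtration A).

HB.instance Definition _ k := GRing.isZmodClosed.Build A (fil F k) (fil_zmod F k).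

(* The finitely supported families (a_k)_k with a_k \in F k; the quotient by  *)
(* those with a_k \in F (k - 1) is the direct sum of the F k / F (k - 1).     *)
Definition rees_pred : {pred laurent A} :=
  fun f => `[< forall k, lcoef k f \in F k >].

Lemma rees_subproof : subring_closed rees_pred.
Proof.
split.
- apply/asboolP => k; rewrite lcoef_mono.
  by case: eqP => [<-|_]; [exact: fil_one | exact: rpred0].
- move=> f g /asboolP Ff /asboolP Fg; apply/asboolP => k.
  rewrite (raddfB (lcoef k)); by apply: rpredB; [apply: Ff|apply: Fg].
move=> f g /asboolP Ff /asboolP Fg; apply/asboolP => k.
rewrite (raddf_sum (lcoef k)) rpred_sum // => i _.
rewrite (raddf_sum (lcoef k)) rpred_sum // => j _.
rewrite /= lcoef_mono; case: eqP => [<-|_]; last exact: rpred0.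
exact: fil_mul.
Qed.

HB.instance Definition _ := GRing.isSubringClosed.Build (laurent A)
  rees_pred rees_subproof.

Record rees := Rees { rees_val :> laurent A; _ : rees_val \in rees_pred }.

HB.instance Definition _ := [isSub for rees_val].
HB.instance Definition _ := [Choice of rees by <:].
HB.instance Definition _ := GRing.SubChoice_isSubPzRing.Build (laurent A) _ rees
  rees_subproof.

Definition gr_ideal : {pred rees} :=
  fun f => `[< forall k, lcoef k (val f) \in F (k - 1) >].

Lemma gr_ideal_subproof : zmod_closed gr_ideal.
Proof.
split=> [|f g /asboolP If /asboolP Ig]; apply/asboolP => k.
  by rewrite !raddf0 rpred0.
by rewrite !raddfB; apply: rpredB; [apply: If|apply: Ig].
Qed.

HB.instance Definition _ := GRing.isZmodClosed.Build rees
  gr_ideal gr_ideal_subproof.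

Lemma gr_idealMl (f g : rees) : g \in gr_ideal -> f * g \in gr_ideal.
Proof.
have /asboolP Ff := valP f; move=> /asboolP Ig; apply/asboolP => k.
rewrite rmorphM /= (raddf_sum (lcoef k)) rpred_sum // => i _.
rewrite (raddf_sum (lcoef k)) rpred_sum // => j _.
rewrite /= lcoef_mono; case: eqP => [<-|_]; last exact: rpred0.
by rewrite -addrA fil_mul.
Qed.

Lemma gr_idealMr (f g : rees) : f \in gr_ideal -> f * g \in gr_ideal.
Proof.
have /asboolP Fg := valP g; move=> /asboolP If; apply/asboolP => k.
rewrite rmorphM /= (raddf_sum (lcoef k)) rpred_sum // => i _.
rewrite (raddf_sum (lcoef k)) rpred_sum // => j _.
rewrite /= lcoef_mono; case: eqP => [<-|_]; last exact: rpred0.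
by rewrite addrAC fil_mul.
Qed.

Definition gr : Type := Quotient.quot gr_ideal.

HB.instance Definition _ := GRing.Zmodule.on gr.
HB.instance Definition _ := EqQuotient.on gr.

Definition gr_pi : rees -> gr := \pi_gr%qT.

Lemma gr_pi_eq (f g : rees) : gr_pi f = gr_pi g <-> f - g \in gr_ideal.
Proof. by rewrite Quotient.idealrBE; split=> [/eqP|/eqP]. Qed.

Lemma gr_pi_repr (g : gr) : gr_pi (repr g) = g.
Proof. exact: reprK. Qed.

Lemma gr_piB : zmod_morphism gr_pi.
Proof. exact: raddfB. Qed.

HB.instance Definition _ := GRing.isZmodMorphism.Build rees gr gr_pi gr_piB.

Definition gr_mul (g h : gr) : gr := gr_pi (repr g * repr h).

Lemma gr_pi_mul (f g : rees) : gr_mul (gr_pi f) (gr_pi g) = gr_pi (f * g).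
Proof.
apply/gr_pi_eq; set f' := repr _; set g' := repr _.
have -> : f' * g' - f * g = f' * (g' - g) + (f' - f) * g.
  by rewrite mulrBr mulrBl addrA subrK.
apply: rpredD; [apply: gr_idealMl|apply: gr_idealMr];
  by apply/gr_pi_eq; rewrite gr_pi_repr.
Qed.

Lemma gr_mulA : associative gr_mul.
Proof.
move=> x y z; rewrite -[x]gr_pi_repr -[y]gr_pi_repr -[z]gr_pi_repr.
by rewrite !gr_pi_mul mulrA.
Qed.

Lemma gr_mul1l : left_id (gr_pi 1) gr_mul.
Proof. by move=> x; rewrite -[x]gr_pi_repr gr_pi_mul mul1r. Qed.

Lemma gr_mul1r : right_id (gr_pi 1) gr_mul.
Proof. by move=> x; rewrite -[x]gr_pi_repr gr_pi_mul mulr1. Qed.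

Lemma gr_mulDl : left_distributive gr_mul +%R.
Proof.
move=> x y z; rewrite -[x]gr_pi_repr -[y]gr_pi_repr -[z]gr_pi_repr.
by rewrite -raddfD !gr_pi_mul mulrDl raddfD.
Qed.

Lemma gr_mulDr : right_distributive gr_mul +%R.
Proof.
move=> x y z; rewrite -[x]gr_pi_repr -[y]gr_pi_repr -[z]gr_pi_repr.
by rewrite -raddfD !gr_pi_mul mulrDr raddfD.
Qed.

HB.instance Definition _ := GRing.Zmodule_isPzRing.Build gr
  gr_mulA gr_mul1l gr_mul1r gr_mulDl gr_mulDr.

(* The class of a \in F k in F k / F (k - 1); it is 0 when a \notin F k.       *)
Definition symbol k (a : A) : gr := gr_pi (insubd 0 (lmono k a)).

(* F k / F (k - 1) as a subgroup of gr.                                      *)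
Definition gr_piece k (g : gr) : Prop := exists2 a, a \in F k & g = symbol k a.

End AssociatedGraded.

(* Linear endomorphisms of the polynomial ring, with composition as product. *)
Section PolyEnd.
Variables (K : fieldType) (n : nat).
Local Notation P := {mpoly K[n]}.

Record pend := PolyEnd { pend_fun :> P -> P; _ : `[< linear pend_fun >] }.

HB.instance Definition _ := [isSub for pend_fun].
HB.instance Definition _ := [Choice of pend by <:].

Implicit Types S T U : pend.

Lemma pend_linear T : linear T.
Proof. exact: asboolW (valP T). Qed.

HB.instance Definition _ T := GRing.isLinear.Build K P P _ T (pend_linear T).

Definition mkpend (f : {linear P -> P}) : pend := PolyEnd (asboolT (linearP f)).

Lemma pendP S T : S =1 T -> S = T.
Proof. by move=> e; apply: val_inj; apply: funext. Qed.

Definition pend_zero := mkpend \0.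
Definition pend_opp T := mkpend (\- T).
Definition pend_add S T := mkpend (S \+ T).
Definition pend_scale (c : K) T := mkpend (c \*: T).
Definition pend_one := mkpend idfun.
Definition pend_mul S T := mkpend (S \o T).

Lemma pend_addA : associative pend_add.
Proof. by move=> S T U; apply: pendP => p; apply: addrA. Qed.
Lemma pend_addC : commutative pend_add.
Proof. by move=> S T; apply: pendP => p; apply: addrC. Qed.
Lemma pend_add0 : left_id pend_zero pend_add.
Proof. by move=> T; apply: pendP => p; apply: add0r. Qed.
Lemma pend_addN : left_inverse pend_zero pend_opp pend_add.
Proof. by move=> T; apply: pendP => p; apply: addNr. Qed.

HB.instance Definition _ := GRing.isZmodule.Build pend
  pend_addA pend_addC pend_add0 pend_addN.

Lemma pend_mulA : associative pend_mul.
Proof. by move=> S T U; apply: pendP. Qed.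
Lemma pend_mul1l : left_id pend_one pend_mul.
Proof. by move=> T; apply: pendP. Qed.
Lemma pend_mul1r : right_id pend_one pend_mul.
Proof. by move=> T; apply: pendP. Qed.
Lemma pend_mulDl : left_distributive pend_mul +%R.
Proof. by move=> S T U; apply: pendP. Qed.
Lemma pend_mulDr : right_distributive pend_mul +%R.
Proof. by move=> S T U; apply: pendP => p; apply: linearD. Qed.
Lemma pend_one_neq0 : pend_one != 0.
Proof.
apply/eqP => /(congr1 (fun T : pend => T 1)) /= /eqP.
by rewrite oner_eq0.
Qed.

HB.instance Definition _ := GRing.Zmodule_isNzRing.Build pend
  pend_mulA pend_mul1l pend_mul1r pend_mulDl pend_mulDr pend_one_neq0.

Lemma pend_scaleA (a b : K) T :
  pend_scale a (pend_scale b T) = pend_scale (a * b) T.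
Proof. by apply: pendP => p; apply: scalerA. Qed.
Lemma pend_scale1 : left_id 1 pend_scale.
Proof. by move=> T; apply: pendP => p; apply: scale1r. Qed.
Lemma pend_scaleDr : right_distributive pend_scale +%R.
Proof. by move=> c S T; apply: pendP => p; apply: scalerDr. Qed.
Lemma pend_scaleDl T : {morph pend_scale^~ T : a b / a + b}.
Proof. by move=> a b; apply: pendP => p; apply: scalerDl. Qed.

HB.instance Definition _ := GRing.Zmodule_isLmodule.Build K pend
  pend_scaleA pend_scale1 pend_scaleDr pend_scaleDl.

Lemma pend_scaleAl (c : K) S T : c *: (S * T) = c *: S * T.
Proof. exact: pendP. Qed.
Lemma pend_scaleAr (c : K) S T : c *: (S * T) = S * (c *: T).
Proof. by apply: pendP => p; rewrite /= linearZ. Qed.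

HB.instance Definition _ := GRing.Lmodule_isLalgebra.Build K pend pend_scaleAl.
HB.instance Definition _ := GRing.Lalgebra_isAlgebra.Build K pend pend_scaleAr.

Lemma mulX_linear (i : 'I_n) : linear (fun p : P => 'X_i * p).
Proof. by move=> c p q; rewrite mulrDr scalerAr. Qed.

Definition pend_x (i : 'I_n) : pend := PolyEnd (asboolT (mulX_linear i)).
Definition pend_d (i : 'I_n) : pend := PolyEnd (asboolT (@mderiv_is_linear n K i)).

(* The Weyl algebra K[x_1, .., x_n]<d_1, .., d_n> as the algebra of operators *)
(* on polynomials generated by the x_i and d_i.  This is the usual Weyl      *)
(* algebra when K has characteristic 0; only complex K is used below.        *)
Definition weyl_pred : {pred pend} := fun T =>
  `[< forall S : {pred pend}, GRing.subalg_closed S ->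
        (forall i, pend_x i \in S) -> (forall i, pend_d i \in S) -> T \in S >].

Lemma weyl_subproof : GRing.subalg_closed weyl_pred.
Proof.
split=> [|c S T /asboolP WS /asboolP WT|S T /asboolP WS /asboolP WT];
  apply/asboolP => Q Qalg Qx Qd; have [Q1 QZ QM] := Qalg => //.
- by apply: QZ; [apply: WS|apply: WT].
- by apply: QM; [apply: WS|apply: WT].
Qed.

HB.instance Definition _ := GRing.isSubalgClosed.Build K pend
  weyl_pred weyl_subproof.

End PolyEnd.

Section Weyl.
Variables (K : fieldType) (n : nat).
Local Notation P := {mpoly K[n]}.
Local Notation weyl_pred := (@weyl_pred K n).

Record weyl := Weyl { weyl_val :> pend K n; _ : weyl_val \in weyl_pred }.

HB.instance Definition _ := [isSub for weyl_val].
HB.instance Definition _ := [Choice of weyl by <:].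
HB.instance Definition _ := [SubChoice_isSubAlgebra of weyl by <:].

Lemma pend_x_weyl i : pend_x K i \in weyl_pred.
Proof. by apply/asboolP => S _ Sx _; apply: Sx. Qed.
Lemma pend_d_weyl i : pend_d K i \in weyl_pred.
Proof. by apply/asboolP => S _ _ Sd; apply: Sd. Qed.

Definition wx i : weyl := Weyl (pend_x_weyl i).
Definition wd i : weyl := Weyl (pend_d_weyl i).

(* x^a d^b *)
Definition wmono (a b : 'X_{1..n}) : weyl :=
  (\prod_(i < n) wx i ^+ a i) * (\prod_(i < n) wd i ^+ b i).

Lemma weylP (S T : weyl) : (forall p, S p = T p) -> S = T.
Proof. by move=> e; apply/val_inj/pendP. Qed.

Lemma weylME (S T : weyl) p : (S * T) p = S (T p). Proof. by []. Qed.
Lemma weylZE c (T : weyl) p : (c *: T) p = c *: T p. Proof. by []. Qed.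
Lemma weylDE (S T : weyl) p : (S + T) p = S p + T p. Proof. by []. Qed.

Lemma wxE i p : wx i p = 'X_i * p. Proof. by []. Qed.
Lemma wdE i p : wd i p = p^`M(i). Proof. by []. Qed.

Lemma wxXE i k p : (wx i ^+ k) p = 'X_i ^+ k * p.
Proof. by elim: k => [|k IH]; rewrite ?mul1r // !exprS weylME IH wxE mulrA -exprS. Qed.

Lemma wdXE i k p : (wd i ^+ k) p = iter k (mderiv i) p.
Proof. by elim: k => [|k IH] //; rewrite exprS weylME IH. Qed.

Lemma wmonoE a b p : wmono a b p = 'X_[a] * p^`M[b].
Proof.
rewrite weylME; set q := (X in pend_fun _ X = _).
have -> : q = p^`M[b].
  rewrite /q /mderivm /index_enum -enumT; elim: (enum _) => [|i s IH].
    by rewrite big_nil.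
  by rewrite big_cons weylME IH wdXE.
rewrite mpolyXE_id; elim: (index_enum _) => [|i s IH].
  by rewrite !big_nil mul1r.
by rewrite !big_cons weylME IH wxXE mulrA.
Qed.

Lemma wx_mono i a b : wx i * wmono a b = wmono (U_(i) + a) b.
Proof. by apply: weylP => p; rewrite weylME !wmonoE wxE mpolyXD mulrA. Qed.

Lemma wd_mono i a b : wd i * wmono a b =
  (a i)%:R *: wmono (a - U_(i)) b + wmono a (b + U_(i)).
Proof.
apply: weylP => p; rewrite weylME weylDE weylZE !wmonoE wdE.
by rewrite mderivM mderivX scalerAl mderivmDm mderivmU1m.
Qed.

Variable d : nat.

(* |a_H|; the variables x_1, .., x_d are those of index i < d.               *)
Definition hdeg (a : 'X_{1..n}) : nat := \sum_(i < n | (i < d)%N) a i.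

(* F_H^j: the span of the x^a d^b with |b_H| <= |a_H| + j.                   *)
Definition V_pred (j : int) : {pred weyl} := fun T =>
  `[< exists s : seq (K * ('X_{1..n} * 'X_{1..n})),
        (forall t, t \in s -> (hdeg t.2.2)%:Z <= (hdeg t.2.1)%:Z + j) /\
        T = \sum_(t <- s) t.1 *: wmono t.2.1 t.2.2 >].

Lemma V_ind (j : int) (Q : weyl -> Prop) :
  Q 0 -> (forall S T, Q S -> Q T -> Q (S + T)) ->
  (forall c a b, (hdeg b)%:Z <= (hdeg a)%:Z + j -> Q (c *: wmono a b)) ->
  forall T, T \in V_pred j -> Q T.
Proof.
move=> Q0 QD Qm T /asboolP [s [hs ->]]; rewrite big_seq.
by apply: (big_ind Q) => // t /hs; apply: Qm.
Qed.

Lemma V_mono (j : int) c a b :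
  (hdeg b)%:Z <= (hdeg a)%:Z + j -> c *: wmono a b \in V_pred j.
Proof.
move=> h; apply/asboolP; exists [:: (c, (a, b))].
by split=> [t|]; rewrite ?big_seq1 // inE => /eqP ->.
Qed.

Lemma V_zmod (j : int) : zmod_closed (V_pred j).
Proof.
split; first by apply/asboolP; exists [::]; rewrite big_nil.
move=> S T /asboolP [s [hs ->]] /asboolP [t [ht ->]]; apply/asboolP.
exists (s ++ [seq (- u.1, u.2) | u <- t]); split=> [u|].
  by rewrite mem_cat => /orP [/hs|/mapP [v /ht hv ->]].
rewrite big_cat big_map /= -sumrN; congr (_ + _).
by apply: eq_bigr => u _; rewrite scaleNr.
Qed.

HB.instance Definition _ j := GRing.isZmodClosed.Build weyl
  (V_pred j) (V_zmod j).

Lemma V_scale (j : int) c T : T \in V_pred j -> c *: T \in V_pred j.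
Proof.
move: T; apply: V_ind => [|S T HS HT|e a b h]; first by rewrite scaler0 rpred0.
  by rewrite scalerDr rpredD.
by rewrite scalerA; apply: V_mono.
Qed.

Lemma V_incl (i j : int) T : i <= j -> T \in V_pred i -> T \in V_pred j.
Proof.
move=> ij; move: T; apply: V_ind => [|S T|c a b h]; first exact: rpred0.
  exact: rpredD.
by apply: V_mono; apply: le_trans h _; rewrite lerD2l.
Qed.

Lemma hdegD a b : hdeg (a + b)%MM = (hdeg a + hdeg b)%N.
Proof. by rewrite /hdeg -big_split; apply: eq_bigr => i _; rewrite mnmDE. Qed.

Lemma hdegU i : hdeg U_(i)%MM = (i < d)%N.
Proof.
rewrite /hdeg big_mkcond (bigD1 i) //= mnm1E eqxx big1 ?addn0.
  by case: ifP.
by move=> k ki; rewrite mnm1E eq_sym (negbTE ki); case: ifP.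
Qed.

Lemma V_one : (1 : weyl) \in V_pred 0.
Proof.
have -> : 1 = 1 *: wmono 0%MM 0%MM.
  by apply: weylP => p; rewrite scale1r wmonoE mpolyX0 mderivm0m mul1r.
by apply: V_mono; rewrite addr0.
Qed.

Lemma V_x i j T : T \in V_pred j -> wx i * T \in V_pred (j - (i < d)%N%:Z).
Proof.
move: T; apply: V_ind => [|S T HS HT|c a b h]; first by rewrite mulr0 rpred0.
  by rewrite mulrDr rpredD.
rewrite -scalerAr wx_mono; apply: V_mono; rewrite hdegD hdegU PoszD.
by apply: le_trans h _; rewrite addrC [X in _ <= X]addrC addrA subrK.
Qed.

Lemma V_d i j T : T \in V_pred j -> wd i * T \in V_pred (j + (i < d)%N%:Z).
Proof.
move: T; apply: V_ind => [|S T HS HT|c a b h]; first by rewrite mulr0 rpred0.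
  by rewrite mulrDr rpredD.
rewrite -scalerAr V_scale // wd_mono rpredD //.
  have [->|ai] := eqVneq (a i) 0%N; first by rewrite scale0r rpred0.
  apply: V_mono; rewrite addrA [_ + j]addrC -addrA -PoszD -hdegU -hdegD submK.
    by rewrite addrC.
  by apply/mnm_lepP => k; rewrite mnm1E; case: eqP => // <-; rewrite lt0n.
rewrite -[wmono _ _]scale1r; apply: V_mono.
by rewrite hdegD hdegU PoszD addrA lerD2r.
Qed.

Lemma V_xs (s : seq 'I_n) (a : 'I_n -> nat) j T : T \in V_pred j ->
  (\prod_(i <- s) wx i ^+ a i) * T
    \in V_pred (j - (\sum_(i <- s | (i < d)%N) a i)%N%:Z).
Proof.
move=> HT; elim: s => [|i s IH]; first by rewrite !big_nil mul1r subr0.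
rewrite !big_cons -mulrA; set U := _ * T in IH *; set w := (X in _ - X%:Z) in IH.
have {}IH k : wx i ^+ k * U \in V_pred (j - w%:Z - (k * (i < d)%N)%N%:Z).
  elim: k => [|k IHk]; first by rewrite mul1r mul0n subr0.
  by rewrite exprS -mulrA mulSn addnC PoszD opprD addrA V_x.
have := IH (a i); case: ifP => _; rewrite ?muln1 ?muln0 ?subr0 //.
by rewrite PoszD opprD addrA addrAC.
Qed.

Lemma V_ds (s : seq 'I_n) (b : 'I_n -> nat) j T : T \in V_pred j ->
  (\prod_(i <- s) wd i ^+ b i) * T
    \in V_pred (j + (\sum_(i <- s | (i < d)%N) b i)%N%:Z).
Proof.
move=> HT; elim: s => [|i s IH]; first by rewrite !big_nil mul1r addr0.
rewrite !big_cons -mulrA; set U := _ * T in IH *; set w := (X in _ + X%:Z) in IH.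
have {}IH k : wd i ^+ k * U \in V_pred (j + w%:Z + (k * (i < d)%N)%N%:Z).
  elim: k => [|k IHk]; first by rewrite mul1r mul0n addr0.
  by rewrite exprS -mulrA mulSn addnC PoszD addrA V_d.
have := IH (b i); case: ifP => _; rewrite ?muln1 ?muln0 ?addr0 //.
by rewrite PoszD addrA addrAC.
Qed.

Lemma V_mul (k l : int) S T :
  S \in V_pred k -> T \in V_pred l -> S * T \in V_pred (k + l).
Proof.
move=> HS HT; move: S HS; apply: V_ind => [|S U HS HU|c a b h].
- by rewrite mul0r rpred0.
- by rewrite mulrDl rpredD.
rewrite -scalerAl V_scale // -mulrA.
apply: V_incl (V_xs _ _ (V_ds _ _ HT)).
rewrite -addrA addrC lerD2r lerBlDl; exact: h.
Qed.

Lemma V_incl1 (k : int) T : T \in V_pred (k - 1) -> T \in V_pred k.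
Proof. by apply: V_incl; rewrite gerBl. Qed.

Definition V_filtration : filtration weyl :=
  Filtration V_zmod V_incl1 V_one V_mul.

End Weyl.

Definition gr_const (K : fieldType) (n d : nat) (c : K) :
  gr (V_filtration K n d) := symbol (V_filtration K n d) 0 c%:A.

(* theta_d = x_1 d_1 + .. + x_d d_d, a class of degree 0 *)
Definition gr_theta (K : fieldType) (n d : nat) : gr (V_filtration K n d) :=
  symbol (V_filtration K n d) 0 (\sum_(i < n | (i < d)%N) wx K i * wd K i).

(* x_1, .., x_d, classes of degree -1 *)
Definition gr_xs (K : fieldType) (n d : nat) : seq (gr (V_filtration K n d)) :=
  [seq symbol (V_filtration K n d) (-1) (wx K i) | i : 'I_n <- enum 'I_n & (i < d)%N].

(* b(g), the coefficients being the classes of the constants in degree 0 *)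
Definition gr_horner (K : fieldType) (n d : nat) (b : {poly K})
    (g : gr (V_filtration K n d)) : gr (V_filtration K n d) :=
  \sum_(i < size b) gr_const n d b`_i * g ^+ i.

Section GradedComplex.
Variables (A : nzRingType) (F : filtration A).

Record is_grading (M : lmodType (gr F)) (M_ : int -> M -> Prop) : Prop :=
  IsGrading {
    grading0 : forall j, M_ j 0;
    gradingB : forall j u v, M_ j u -> M_ j v -> M_ j (u - v);
    grading_sum : forall u, exists (s : seq int) (f : int -> M),
      (forall j, M_ j (f j)) /\ u = \sum_(j <- s) f j;
    grading_direct : forall (s : seq int) (f : int -> M), uniq s ->
      (forall j, M_ j (f j)) -> \sum_(j <- s) f j = 0 ->
      forall j, j \in s -> f j = 0;
    grading_act : forall k j g u,
      gr_piece k g -> M_ j u -> M_ (j + k) (g *: u)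
  }.

(* The differential into term i is indexed by its target, so that composites *)
(* and total complexes are well typed without transporting along equalities  *)
(* of integers.                                                              *)
Record graded_complex := GradedComplex {
  cterm : int -> lmodType (gr F);
  cpiece : forall i : int, int -> cterm i -> Prop;
  cdiff : forall i : int, {linear cterm (i - 1) -> cterm i};
  cpiece_grading : forall i, is_grading (@cpiece i);
  cdiff_piece : forall i j u, @cpiece (i - 1) j u -> @cpiece i j (cdiff i u);
  cdiff_cdiff : forall i u, cdiff i (cdiff (i - 1) u) = 0
}.

End GradedComplex.

Section Koszul.
Variables (A : nzRingType) (F : filtration A) (L : graded_complex F).

(* Koszul complex of L on a list of elements of degree -1, the LAST variable *)
(* being the head of the list.  For x :: xs it is the total complex of the   *)
(* two rows K(L_{.+1}, xs)[k] and K(L, xs)[k], joined by (-1)^i x; here      *)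
(* K(L_{.+1}, xs)[k] is K(L, xs)[k + 1].  The degree k enters only through   *)
(* the subgroup kdeg xs k m of the ambient module kterm xs m, on which the   *)
(* ring acts componentwise.                                                  *)
Fixpoint kterm (xs : seq (gr F)) (m : int) : lmodType (gr F) :=
  if xs is _ :: xs' then (kterm xs' m * kterm xs' (m - 1))%type else cterm L m.

Fixpoint kdeg (xs : seq (gr F)) (k m : int) : kterm xs m -> Prop :=
  match xs return kterm xs m -> Prop with
  | [::] => @cpiece _ _ L m k
  | _ :: xs' => fun u => kdeg (k + 1) u.1 /\ kdeg k u.2
  end.

Fixpoint kdiff (xs : seq (gr F)) (m : int) : kterm xs (m - 1) -> kterm xs m :=
  match xs return kterm xs (m - 1) -> kterm xs m with
  | [::] => cdiff L m
  | x :: xs' => fun u =>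
      (kdiff u.1, ((-1) ^+ `|(m - 1)%R|%N * x) *: u.1 + kdiff u.2)
  end.

(* Exactness at every spot of K(L, x_1, .., x_r)[k], for xs = [:: x_1; ..; x_r]: *)
(* kernel equals image; rev puts the last variable at the head, as above.    *)
Definition koszul_exact (xs : seq (gr F)) (k : int) : Prop :=
  forall (m : int) (u : kterm (rev xs) (m - 1)), kdeg k u ->
    kdiff u = 0 <->
    exists2 v : kterm (rev xs) (m - 1 - 1), kdeg k v & kdiff v = u.

End Koszul.

(* Main.v *)
From HB Require Import structures.
Require Import Defs.
From mathcomp Require Import all_boot all_order all_algebra.
From mathcomp Require Import boolp reals complex mpoly.
Import GRing.Theory Num.Theory.
Local Open Scope ring_scope.

Set Implicit Arguments.
Unset Strict Implicit.
Unset Printing Implicit Defensive.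

(** Let K be the Koszul complex on x_1, .., x_d ending in degree k.  Writing
    Theta for theta_d + j on the part of internal degree j, Theta is an
    endomorphism of K, and contracting with the d_i is a homotopy between
    Theta and the scalar k.  On the other hand K is an iterated mapping cone of
    shifts of L, and b(Theta) kills the cohomology of L, so a power of b(Theta)
    kills the cohomology of K.  Hence so does a power of the unit b(k). *)

(** * Arithmetic of symbols and homogeneous pieces in the associated graded ring *)

Section Symbols.
Variables (A : nzRingType) (F : filtration A).

(** This membership keeps [insubd] in [symbol] away from its default value 0, so every computation
    with symbols below rests on it. *)
Lemma lmono_rees k a : a \in F k -> lmono k a \in rees_pred F.
Proof.
move=> Fa; apply/asboolP => l; rewrite lcoef_mono.
by case: eqP => [<-|_]; [exact: Fa | exact: (rpred0 (fil F l))].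
Qed.

Lemma symbolM k l a b : a \in F k -> b \in F l ->
  symbol F k a * symbol F l b = symbol F (k + l) (a * b).
Proof.
move=> Fa Fb; rewrite -[LHS]/(gr_mul _ _) gr_pi_mul; congr gr_pi.
apply: val_inj; rewrite rmorphM /= !insubdK ?lmono_rees ?fil_mul //.
exact: lmul_mono.
Qed.

Lemma symbolD k a b : a \in F k -> b \in F k ->
  symbol F k (a + b) = symbol F k a + symbol F k b.
Proof.
move=> Fa Fb; have Fab : a + b \in F k := rpredD Fa Fb.
rewrite /symbol -raddfD; congr gr_pi; apply: val_inj.
by rewrite [RHS]raddfD /= !insubdK ?lmono_rees // (raddfD (lmono _)).
Qed.

Lemma symbol0 k : symbol F k 0 = 0.
Proof.
have F0 := rpred0 (fil F k).
by apply: (addrI (symbol F k 0)); rewrite -symbolD // !addr0.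
Qed.

Lemma symbol1 : symbol F 0 1 = 1.
Proof.
congr gr_pi; apply: val_inj.
by rewrite insubdK ?lmono_rees ?fil_one.
Qed.

Lemma symbol_sum k (I : Type) (s : seq I) (P : pred I) (a : I -> A) :
  (forall i, P i -> a i \in F k) ->
  symbol F k (\sum_(i <- s | P i) a i) = \sum_(i <- s | P i) symbol F k (a i).
Proof.
(* [symbolD] needs both summands in [F k], so membership of the partial sums is carried through the
   induction together with the equation. *)
move=> Fa; pose R x y := x \in F k /\ symbol F k x = y.
suff [] : R (\sum_(i <- s | P i) a i) (\sum_(i <- s | P i) symbol F k (a i)).
  by [].
elim/big_rec2: _ => [|i y x Pi [Fx <-]].
  by split; [exact: (rpred0 (fil F k)) | exact: symbol0].
by split; [exact: (rpredD (Fa i Pi) Fx) | rewrite symbolD ?Fa].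
Qed.

Lemma gr_piece_symbol k a : a \in F k -> gr_piece k (symbol F k a).
Proof. by exists a. Qed.

Lemma gr_pieceB k (g h : gr F) :
  gr_piece k g -> gr_piece k h -> gr_piece k (g - h).
Proof.
move=> [a Fa ->] [b Fb ->]; exists (a - b); first exact: (rpredB Fa Fb).
apply/eqP; rewrite subr_eq -symbolD //; last exact: (rpredB Fa Fb).
by rewrite subrK.
Qed.

Lemma gr_piece0 k : gr_piece k (0 : gr F).
Proof.
by rewrite -(symbol0 k); apply: gr_piece_symbol; exact: (rpred0 (fil F k)).
Qed.

Lemma gr_pieceD k (g h : gr F) :
  gr_piece k g -> gr_piece k h -> gr_piece k (g + h).
Proof.
move=> Pg Ph; rewrite -[h]opprK; apply: gr_pieceB => //.
by rewrite -sub0r; apply: gr_pieceB => //; apply: gr_piece0.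
Qed.

Lemma gr_piece1 : gr_piece 0 (1 : gr F).
Proof. by rewrite -symbol1; apply/gr_piece_symbol/fil_one. Qed.

Lemma gr_pieceM k l (g h : gr F) :
  gr_piece k g -> gr_piece l h -> gr_piece (k + l) (g * h).
Proof.
move=> [a Fa ->] [b Fb ->]; exists (a * b); first exact: fil_mul.
by rewrite symbolM.
Qed.

Lemma gr_piece_int (z : int) : gr_piece 0 (z%:~R : gr F).
Proof.
have Pn m : gr_piece 0 (m%:R : gr F).
  elim: m => [|m IH]; first exact: gr_piece0.
  by rewrite -natr1; apply: gr_pieceD => //; apply: gr_piece1.
case: z => m; first exact: Pn.
by rewrite NegzE mulrNz -sub0r; apply: gr_pieceB; [exact: gr_piece0 | exact: Pn].
Qed.

Lemma gr_pieceX0 (g : gr F) m : gr_piece 0 g -> gr_piece 0 (g ^+ m).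
Proof.
move=> Pg; elim: m => [|m IH]; first exact: gr_piece1.
by rewrite exprS -[0]addr0; apply: gr_pieceM.
Qed.

Lemma gr_piece_sign k m (g : gr F) : gr_piece k g -> gr_piece k ((-1) ^+ m * g).
Proof.
move=> Pg; rewrite -[k]add0r; apply: gr_pieceM => //.
by apply: gr_pieceX0; exact: (gr_piece_int (-1)).
Qed.

End Symbols.

(** The absolute value has the parity of [m], also for negative [m]. The opposite signs at
    consecutive spots make the cross terms of the cones cancel. *)
Lemma absz_sign_pred (R : pzRingType) (m : int) :
  (-1) ^+ `|(m - 1)%R|%N = - (-1) ^+ `|m|%N :> R.
Proof.
case: m => [[|m]|m]; first by [].
  by rewrite -addn1 PoszD addrK /= addn1 exprS mulN1r opprK.
have -> : Negz m - 1 = Negz m.+1 by rewrite !NegzE -opprD -PoszD addn1.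
by rewrite /= exprS mulN1r.
Qed.

(** * Degreewise operators and boundaries on the Koszul complex *)

Section KoszulComplex.
Variables (A : nzRingType) (F : filtration A) (L : graded_complex F).
Implicit Types (xs : seq (gr F)) (g h : int -> gr F).

(* [g j] acting on the part of internal degree [j] of the Koszul complex. *)
Fixpoint kact g xs (k m : int) : kterm L xs m -> kterm L xs m :=
  match xs return kterm L xs m -> kterm L xs m with
  | [::] => fun u => g k *: u
  | _ :: _ => fun u => (kact g (k + 1) u.1, kact g k u.2)
  end.

(** For [x] of degree -1, this is the commutation of [x] with the operator that acts as [g j] in
    each degree [j]. *)
Definition intertwines g (x : gr F) := forall j, x * g (j + 1) = g j * x.

(** Scalars become a special case of [kact], so that facts about them follow from those about
    degreewise operators. *)
Lemma kact_const (a : gr F) xs k m (u : kterm L xs m) :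
  kact (fun=> a) k u = a *: u.
Proof. by elim: xs k m u => [|x xs IH] k m // [u v] /=; rewrite !IH. Qed.

Lemma kactDl g h xs k m (u : kterm L xs m) :
  kact (fun j => g j + h j) k u = kact g k u + kact h k u.
Proof.
elim: xs k m u => [|x xs IH] k m => [u|[u v]] /=; first by rewrite scalerDl.
by rewrite !IH.
Qed.

Lemma kactM g h xs k m (u : kterm L xs m) :
  kact (fun j => g j * h j) k u = kact g k (kact h k u).
Proof.
elim: xs k m u => [|x xs IH] k m => [u|[u v]] /=; first by rewrite scalerA.
by rewrite !IH.
Qed.

Lemma eq_kact g h xs k m (u : kterm L xs m) :
  g =1 h -> kact g k u = kact h k u.
Proof.
move=> gh; elim: xs k m u => [|x xs IH] k m => [u|[u v]] /=; first by rewrite gh.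
by rewrite !IH.
Qed.

Lemma kact_suml (I : Type) (r : seq I) (g : I -> int -> gr F) xs k m
    (u : kterm L xs m) :
  kact (fun j => \sum_(i <- r) g i j) k u = \sum_(i <- r) kact (g i) k u.
Proof.
elim: r => [|i r IH].
  rewrite big_nil (eq_kact (h := fun=> 0)) ?kact_const ?scale0r // => j.
  by rewrite big_nil.
by rewrite big_cons -IH -kactDl; apply: eq_kact => j; rewrite big_cons.
Qed.

Lemma kactB g xs k m (u v : kterm L xs m) :
  kact g k (u - v) = kact g k u - kact g k v.
Proof.
elim: xs k m u v => [|x xs IH] k m => [u v|[u1 u2] [v1 v2]] /=.
  by rewrite scalerBr.
by rewrite !IH.
Qed.

Lemma kact0 g xs k m : kact g k (0 : kterm L xs m) = 0.
Proof. by rewrite -[X in kact g k X](subrr 0) kactB subrr. Qed.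

Lemma kactD g xs k m (u v : kterm L xs m) :
  kact g k (u + v) = kact g k u + kact g k v.
Proof. by rewrite -{2}(addrK v u) kactB subrK. Qed.

Lemma kact_intertwine g x xs k m (u : kterm L xs m) : intertwines g x ->
  x *: kact g (k + 1) u = kact g k (x *: u).
Proof.
move=> gx; elim: xs k m u => [|y xs IH] k m => [u|[u v]] /=.
  by rewrite !scalerA gx.
by rewrite -!IH.
Qed.

Lemma intertwines_sign g x m : intertwines g x ->
  intertwines g ((-1) ^+ m * x).
Proof. by move=> gx j; rewrite -mulrA gx !mulrA commr_sign. Qed.

Lemma intertwinesX g x m : intertwines g x ->
  intertwines (fun j => g j ^+ m) x.
Proof.
move=> gx j; elim: m => [|m IH]; first by rewrite mulr1 mul1r.
by rewrite exprS mulrA gx -mulrA IH mulrA -exprS.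
Qed.

Lemma kdiff_is_additive xs m : zmod_morphism (@kdiff A F L xs m).
Proof.
elim: xs m => [|x xs IH] m => [u v|[u1 u2] [v1 v2]] /=; first by rewrite raddfB.
congr (_, _); first by rewrite IH.
by rewrite IH scalerBr addrACA -opprD.
Qed.

HB.instance Definition _ xs m := GRing.isZmodMorphism.Build _ _
  (@kdiff A F L xs m) (@kdiff_is_additive xs m).

(** On [L] this is linearity of the differential. Each cone map multiplies the row of degree [k + 1]
    into the row of degree [k], which is where intertwining is used. *)
Lemma kdiff_kact g xs k m (u : kterm L xs (m - 1)) :
  (forall x, x \in xs -> intertwines g x) ->
  kdiff (kact g k u) = kact g k (kdiff u).
Proof.
elim: xs k m u => [|x xs IH] k m => [u|[u v]] /= gxs; first by rewrite linearZ.
have gxs' y : y \in xs -> intertwines g y.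
  by move=> ys; apply: gxs; rewrite inE ys orbT.
have gx := gxs x (mem_head _ _).
rewrite !IH //; congr (_, _).
rewrite kact_intertwine; last exact: intertwines_sign.
by rewrite kactD.
Qed.

Lemma kdiffZ (a : gr F) xs m (u : kterm L xs (m - 1)) :
  (forall x, x \in xs -> x * a = a * x) -> kdiff (a *: u) = a *: kdiff u.
Proof.
by move=> axs; rewrite -!(kact_const a 0) kdiff_kact // => x /axs ax j.
Qed.

(** Within the rows this is induction. The new variable [x] commutes with the others, hence passes
    through [kdiff], and the two cross terms have opposite signs. *)
Lemma kdiff_kdiff xs m (u : kterm L xs (m - 1 - 1)) :
  {in xs &, forall x y, x * y = y * x} -> kdiff (kdiff u) = 0.
Proof.
elim: xs m u => [|x xs IH] m => [u|[u v]] /= Cxs; first exact: cdiff_cdiff.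
have Cxs' : {in xs &, forall y z, y * z = z * y}.
  by move=> y z ys zs; apply: Cxs; rewrite inE ?ys ?zs orbT.
rewrite raddfD /= !IH // addr0 kdiffZ; last first.
  move=> y ys; rewrite mulrA commr_sign -mulrA -(Cxs x y) ?mem_head ?mulrA //.
  by rewrite inE ys orbT.
by rewrite -scalerDl -mulrDl (absz_sign_pred _ (m - 1)) addrN mul0r scale0r.
Qed.

Lemma kdegB xs k m (u v : kterm L xs m) :
  kdeg k u -> kdeg k v -> kdeg k (u - v).
Proof.
elim: xs k m u v => [|x xs IH] k m => [u v|[u1 u2] [v1 v2]] /=.
  exact: (gradingB (cpiece_grading L m)).
by move=> [? ?] [? ?]; split; apply: IH.
Qed.

Lemma kdeg0 xs k m : kdeg k (0 : kterm L xs m).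
Proof.
elim: xs k m => [|x xs IH] k m //=.
exact: (grading0 (cpiece_grading L m)).
Qed.

Lemma kdegD xs k m (u v : kterm L xs m) :
  kdeg k u -> kdeg k v -> kdeg k (u + v).
Proof.
move=> ku kv; rewrite -[v]opprK; apply: kdegB => //.
by rewrite -sub0r; apply: kdegB => //; apply: kdeg0.
Qed.

Lemma kdeg_scale (a : gr F) l xs k m (u : kterm L xs m) :
  gr_piece l a -> kdeg k u -> kdeg (k + l) (a *: u).
Proof.
move=> Pa; elim: xs k m u => [|x xs IH] k m => [u|[u v]] /=.
  exact: (grading_act (cpiece_grading L m)).
by move=> [ku kv]; split; [rewrite addrAC|]; apply: IH.
Qed.

Lemma kdeg_kact g xs k m (u : kterm L xs m) :
  (forall j, gr_piece 0 (g j)) -> kdeg k u -> kdeg k (kact g k u).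
Proof.
move=> Pg; elim: xs k m u => [|x xs IH] k m => [u|[u v]] /=.
  by rewrite -{2}[k]addr0; apply: (grading_act (cpiece_grading L m)).
by move=> [ku kv]; split; apply: IH.
Qed.

(** This is the image side of [koszul_exact]. Statements on cohomology are phrased as congruences
    modulo this subgroup, without forming a quotient. *)
Definition kboundary xs k m (u : kterm L xs (m - 1)) : Prop :=
  exists2 v : kterm L xs (m - 1 - 1), kdeg k v & kdiff v = u.

Lemma kboundaryB xs k m (u v : kterm L xs (m - 1)) :
  kboundary k u -> kboundary k v -> kboundary k (u - v).
Proof.
move=> [u' ku <-] [v' kv <-]; exists (u' - v'); first exact: kdegB.
exact: raddfB.
Qed.

Lemma kboundary0 xs k m : kboundary k (0 : kterm L xs (m - 1)).
Proof. by exists 0; [exact: kdeg0 | exact: raddf0]. Qed.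

Lemma kboundaryD xs k m (u v : kterm L xs (m - 1)) :
  kboundary k u -> kboundary k v -> kboundary k (u + v).
Proof.
move=> ku kv; rewrite -[v]opprK; apply: kboundaryB => //.
by rewrite -sub0r; apply: kboundaryB => //; apply: kboundary0.
Qed.

Lemma kboundary_kact g xs k m (u : kterm L xs (m - 1)) :
  (forall x, x \in xs -> intertwines g x) -> (forall j, gr_piece 0 (g j)) ->
  kboundary k u -> kboundary k (kact g k u).
Proof.
move=> gxs Pg [v kv <-]; exists (kact g k v); first exact: kdeg_kact.
exact: kdiff_kact.
Qed.

Lemma kboundaryZ (a : gr F) xs k m (u : kterm L xs (m - 1)) :
  (forall x, x \in xs -> x * a = a * x) -> gr_piece 0 a ->
  kboundary k u -> kboundary k (a *: u).
Proof.
move=> axs Pa ku; rewrite -(kact_const a k); apply: kboundary_kact => //.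
by move=> x /axs ax j.
Qed.

(** Induction by telescoping: g^(N+1) - c^(N+1) = g (g^N - c^N) + c^N (g - c), where [g] and [c]
    both preserve boundaries. *)
Lemma kboundary_kactX g (c : gr F) xs k m (u : kterm L xs (m - 1)) N :
  (forall x, x \in xs -> intertwines g x) -> (forall j, gr_piece 0 (g j)) ->
  (forall x, x \in xs -> x * c = c * x) -> gr_piece 0 c ->
  (forall j, g j * c = c * g j) ->
  kboundary k (kact g k u - c *: u) ->
  kboundary k (kact (fun j => g j ^+ N) k u - c ^+ N *: u).
Proof.
move=> gxs Pg cxs Pc gc ku; elim: N => [|N IH].
  rewrite (eq_kact (h := fun=> 1)) ?kact_const ?subrr //.
  exact: kboundary0.
have -> : kact (fun j => g j ^+ N.+1) k u - c ^+ N.+1 *: u =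
    kact g k (kact (fun j => g j ^+ N) k u - c ^+ N *: u)
    + c ^+ N *: (kact g k u - c *: u).
  rewrite kactB -kactM scalerBr scalerA -exprSr.
  rewrite (eq_kact (h := fun j => g j * g j ^+ N)); last by move=> j; rewrite exprS.
  have -> : kact g k (c ^+ N *: u) = c ^+ N *: kact g k u.
    rewrite -(kact_const (c ^+ N) k u) -(kact_const _ k) -!kactM.
    by apply: eq_kact => j; apply: commrX.
  by rewrite addrA subrK.
apply: kboundaryD; first exact: kboundary_kact.
by apply: kboundaryZ => // [x /cxs cx|]; [exact: commrX | exact: gr_pieceX0].
Qed.

(* Each added variable makes the complex a mapping cone, which at worst       *)
(* squares the operator needed to kill the cohomology.                       *)
Lemma kact_annihilates g xs :
  (forall (i j : int) (u : cterm L (i - 1)),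
     cpiece j u -> cdiff L i u = 0 ->
     exists2 v : cterm L (i - 1 - 1), cpiece j v & cdiff L (i - 1) v = g j *: u) ->
  (forall x, x \in xs -> gr_piece (-1) x) ->
  {in xs &, forall x y, x * y = y * x} ->
  (forall x, x \in xs -> intertwines g x) -> (forall j, gr_piece 0 (g j)) ->
  exists N, forall (k m : int) (u : kterm L xs (m - 1)), kdeg k u -> kdiff u = 0 ->
    kboundary k (kact (fun j => g j ^+ N) k u).
Proof.
move=> g_ann; elim: xs => [|x xs IH] Pxs Cxs gxs Pg.
  exists 1%N => k m u ku du; have [v kv dv] := g_ann _ _ _ ku du.
  by exists v.
have {}IH : exists N, forall (k m : int) (u : kterm L xs (m - 1)),
    kdeg k u -> kdiff u = 0 -> kboundary k (kact (fun j => g j ^+ N) k u).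
  apply: IH => // [y ys|y z ys zs|y ys]; [apply: Pxs|apply: Cxs|apply: gxs];
    by rewrite inE ?ys ?zs orbT.
have [N HN] := IH; exists (N + N)%N => k m [u v] /= [ku kv] [du duv].
have gN y : y \in x :: xs -> intertwines (fun j => g j ^+ N) y.
  by move=> /gxs /intertwinesX.
have gN' y : y \in xs -> intertwines (fun j => g j ^+ N) y.
  by move=> ys; apply: gN; rewrite inE ys orbT.
have PgN j : gr_piece 0 (g j ^+ N) by apply: gr_pieceX0.
have [w kw dw] := HN _ _ _ ku du.
pose e : gr F := (-1) ^+ `|(m - 1 - 1)%R|%N * x.
have Pe : gr_piece (-1) e by apply/gr_piece_sign/Pxs/mem_head.
(* Consecutive signs being opposite, the cycle condition [duv] says [kdiff v = e *: u]. Hence g^N v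
   and [e *: w] have the same differential, and their difference is a cycle of the second row, to
   which the induction hypothesis applies again. *)
have [] := HN k (m - 1) (kact (fun j => g j ^+ N) k v - e *: w).
- apply: kdegB; first exact: kdeg_kact.
  by rewrite -[k](addrK 1); apply: kdeg_scale.
- rewrite raddfB /= kdiff_kact // kdiffZ; last first.
    move=> y ys; rewrite mulrA commr_sign -mulrA -(Cxs x y) ?mem_head ?mulrA //.
    by rewrite inE ys orbT.
  rewrite dw kact_intertwine; last exact/intertwines_sign/gN/mem_head.
  rewrite -kactB -[kdiff v](addKr (((-1) ^+ `|(m - 1)%R|%N * x) *: u)) duv addr0.
  rewrite -[X in kact _ _ (- X - _)]opprK -scaleNr -mulNr.
  rewrite -(absz_sign_pred _ (m - 1)) opprK.
  by rewrite subrr kact0.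
move=> w' kw' dw'.
(* The cone map sends g^N w to e g^N w, which cancels the correction in [kdiff w'], namely g^N
   applied to g^N v - e w. Both components are left with g^(N+N). *)
exists (kact (fun j => g j ^+ N) (k + 1) w, w').
  by split => //=; apply: kdeg_kact.
rewrite /= kdiff_kact // dw dw'; congr (_, _).
  by rewrite -kactM; apply: eq_kact => j; rewrite exprD.
rewrite kact_intertwine; last exact/intertwines_sign/gN/mem_head.
rewrite kactB addrCA subrr addr0 -kactM; apply: eq_kact => j.
by rewrite exprD.
Qed.

(** * The contraction homotopy for elements obeying the Heisenberg relations *)

Section Homotopy.
Variables (I : eqType) (X D : I -> gr F).
Hypothesis XD : forall i j, D i * X j = X j * D i + (i == j)%:R.
Hypothesis degD : forall i, gr_piece 1 (D i).

(* The operator [\sum_i D i \otimes \iota_i], where [\iota_i] is the          *)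
(* contraction with the i-th dual basis vector.                              *)
Fixpoint khom (s : seq I) (m : int) :
    kterm L (map X s) m -> kterm L (map X s) (m - 1) :=
  match s return kterm L (map X s) m -> kterm L (map X s) (m - 1) with
  | [::] => fun=> 0
  | i :: _ => fun u =>
      (khom u.1 + ((-1) ^+ `|(m - 1)%R|%N * D i) *: u.2, khom u.2)
  end.

Lemma khomB s m (u v : kterm L (map X s) m) : khom (u - v) = khom u - khom v.
Proof.
elim: s m u v => [|i s IH] m => [u v|[u1 u2] [v1 v2]] /=; first by rewrite subrr.
by rewrite !IH; congr (_, _); rewrite scalerBr addrACA -opprD.
Qed.

Lemma khomD s m (u v : kterm L (map X s) m) : khom (u + v) = khom u + khom v.
Proof. by rewrite -{2}(addrK v u) khomB subrK. Qed.

Lemma khomZ (a : gr F) s m (u : kterm L (map X s) m) :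
  (forall i, i \in s -> D i * a = a * D i) -> khom (a *: u) = a *: khom u.
Proof.
elim: s m u => [|i s IH] m => [u|[u v]] /= Ca; first by rewrite scaler0.
have Cs j : j \in s -> D j * a = a * D j.
  by move=> js; apply: Ca; rewrite inE js orbT.
rewrite !IH //; congr (_, _); rewrite scalerDr !scalerA; congr (_ + _ *: _).
by rewrite -mulrA Ca ?mem_head // !mulrA commr_sign.
Qed.

Lemma kdeg_khom s k m (u : kterm L (map X s) m) : kdeg k u -> kdeg k (khom u).
Proof.
elim: s k m u => [|i s IH] k m => [u|[u v]] /=.
  by move=> _; apply: (@kdeg0 [::]).
move=> [ku kv]; split; last exact: IH.
apply: kdegD; first exact: IH.
by apply: kdeg_scale => //; apply: gr_piece_sign.
Qed.

(** Each index [i] contributes [X i * D i] where e_i occurs in the wedge, and [D i * X i], that is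
    [X i * D i + 1], where it is absent. In internal degree [j] the number of absent indices is
    [j - k]. *)
Lemma khom_homotopy s k m (u : kterm L (map X s) (m - 1)) : uniq s ->
  kdiff (khom u) + khom (kdiff u) =
  kact (fun j => \sum_(i <- s) X i * D i + (j - k)%:~R) k u.
Proof.
elim: s k m u => [|i s IH] k m => [u _|[u v]] /=.
  by rewrite raddf0 addr0 big_nil add0r subrr scale0r.
move=> /andP [is' us].
have C y : y \in map X s -> y * D i = D i * y.
  move=> /mapP [l ls ->]; rewrite XD; case: eqP => [il|_]; last by rewrite addr0.
  by rewrite il ls in is'.
set e := (-1) ^+ `|(m - 1)%R|%N; set e' := (-1) ^+ `|(m - 1 - 1)%R|%N.
have e'E : e' = - e :> gr F by apply: absz_sign_pred.
have ee : e * e = 1 :> gr F by rewrite -expr2 sqrr_sign.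
have Ce (y : gr F) : e * y = y * e by rewrite commr_sign.
have Cee (a b : gr F) : e * a * (e * b) = a * b.
  by rewrite (Ce a) -mulrA (mulrA e e) ee mul1r.
(* As [i] is not in [s], [D i] commutes with the other [X j], and [X i] with the other [D j]. The
   mixed terms then cancel, because [e'] is [- e]. *)
have De y : y \in map X s -> y * (e' * D i) = e' * D i * y.
  by move=> ys; rewrite e'E mulrA mulrN -Ce -mulNr -!mulrA C.
have Xe j : j \in s -> D j * (e * X i) = e * X i * D j.
  move=> js; rewrite mulrA -(Ce (D j)) -!mulrA XD; case: eqP => [ji|_].
    by rewrite -ji js in is'.
  by rewrite addr0.
congr (_, _) => /=.
  rewrite raddfD /= kdiffZ // scalerDr scalerA Cee e'E mulNr scaleNr.
  rewrite addrACA (IH (k + 1)) // [_ *: u + _]addrC addKr.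
  rewrite -(kact_const _ (k + 1)) -kactDl.
  (* In the first row the induction hypothesis is used at [k + 1]; the 1 from the commutator turns
     [j - (k + 1)] into [j - k]. *)
  apply: eq_kact => j; rewrite big_cons XD eqxx addrACA [X in X + _]addrC.
  by rewrite -(intrD _ _ 1) opprD addrA subrK.
rewrite khomD khomZ // scalerDr scalerA e'E !mulNr mulrN opprK Cee scaleNr.
rewrite addrACA (IH k) // [- _ + _]addrC subrK -(kact_const _ k) -kactDl.
by apply: eq_kact => j; rewrite big_cons addrA.
Qed.

(** The commutator of theta with [X i] is [X i] itself, and the passage from [j + 1] to [j] absorbs
    it. This is why theta is shifted by the degree. *)
Lemma intertwines_theta s i : uniq s -> i \in s ->
  {in s &, forall l j, X l * X j = X j * X l} ->
  intertwines (fun j => \sum_(l <- s) X l * D l + j%:~R) (X i).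
Proof.
move=> us si XX j; rewrite mulrDr mulrDl mulr_suml.
have -> : \sum_(l <- s) X l * D l * X i = X i * (\sum_(l <- s) X l * D l) + X i.
  rewrite mulr_sumr (bigD1_seq i) //= [in RHS](bigD1_seq i) //= -!mulrA.
  rewrite XD eqxx mulrDr mulr1 addrAC; congr (_ + _ + _).
  rewrite big_seq_cond [RHS]big_seq_cond; apply: eq_bigr => l /andP [ls li].
  by rewrite -mulrA XD (negbTE li) addr0 !mulrA (XX l i).
by rewrite intrD mulrDr mulr1 -addrA commr_int [X in _ + X]addrC.
Qed.

(** On a cycle the term [khom (kdiff u)] of the homotopy identity vanishes, so [khom u] is the
    required primitive. *)
Lemma kboundary_theta s k m (u : kterm L (map X s) (m - 1)) :
  uniq s -> kdeg k u -> kdiff u = 0 ->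
  kboundary k
    (kact (fun j => \sum_(i <- s) X i * D i + j%:~R) k u - k%:~R *: u).
Proof.
move=> us ku du; exists (khom u); first exact: kdeg_khom.
have := khom_homotopy k u us; rewrite du.
have -> : khom (0 : kterm L (map X s) m) = 0.
  by rewrite -(subrr (0 : kterm L (map X s) m)) khomB subrr.
rewrite addr0 => ->; rewrite -scaleNr -(kact_const _ k) -kactDl.
by apply: eq_kact => j; rewrite intrB addrA.
Qed.

End Homotopy.
End KoszulComplex.

(** * Relations and constants in the graded ring of the Weyl algebra *)

Section WeylSymbols.
Variables (K : fieldType) (n d : nat) (le_dn : (d <= n)%N).
Local Notation F := (V_filtration K n d).

(** Indexing by ['I_d] instead of filtering ['I_n] makes the degree -1 hold without side condition
    and fits the homotopy, which is indexed by a list. *)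
Definition gr_x (i : 'I_d) : gr F := symbol F (-1) (wx K (widen_ord le_dn i)).
Definition gr_d (i : 'I_d) : gr F := symbol F 1 (wd K (widen_ord le_dn i)).

Lemma V_wx (i : 'I_d) : wx K (widen_ord le_dn i) \in F (-1).
Proof.
by have := V_x (widen_ord le_dn i) (V_one K n d); rewrite mulr1 /= ltn_ord.
Qed.

Lemma V_wd (i : 'I_d) : wd K (widen_ord le_dn i) \in F 1.
Proof.
by have := V_d (widen_ord le_dn i) (V_one K n d); rewrite mulr1 /= ltn_ord.
Qed.

Lemma V_const (c : K) : c%:A \in F 0.
Proof. exact: V_scale (V_one K n d). Qed.

Lemma wx_comm (i j : 'I_n) : wx K i * wx K j = wx K j * wx K i.
Proof. by apply: weylP => p; rewrite !weylME !wxE mulrCA. Qed.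

Lemma wd_wx (i j : 'I_n) : wd K i * wx K j = wx K j * wd K i + (i == j)%:R.
Proof.
have -> : (i == j)%:R = (i == j)%:R *: (1 : weyl K n) by rewrite scaler_nat.
apply: weylP => p; rewrite weylDE weylZE !weylME !wdE !wxE mderivM mderivX.
rewrite mnm1E addrC [j == i]eq_sym; congr (_ + _).
have [->|_] := eqVneq i j; last by rewrite !scale0r mul0r.
have -> : (U_(j) - U_(j) = 0 :> 'X_{1..n})%MM.
  by apply/mnmP => l; rewrite mnmBE mnm0E subnn.
by rewrite mpolyX0 !scale1r mul1r.
Qed.

Lemma gr_xC i j : gr_x i * gr_x j = gr_x j * gr_x i.
Proof. by rewrite /gr_x !symbolM ?V_wx // wx_comm. Qed.

Lemma gr_dx i j : gr_d i * gr_x j = gr_x j * gr_d i + (i == j)%:R.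
Proof.
rewrite /gr_x /gr_d !symbolM ?V_wx ?V_wd // wd_wx.
have -> : (widen_ord le_dn i == widen_ord le_dn j) = (i == j) by [].
rewrite symbolD.
- by case: eqP => _; rewrite ?symbol1 ?symbol0.
- exact: (fil_mul (V_wx j) (V_wd i)).
by case: eqP => _; [exact: fil_one | exact: rpred0 (V_pred d 0)].
Qed.

Lemma gr_piece_x i : gr_piece (-1) (gr_x i).
Proof. by apply/gr_piece_symbol/V_wx. Qed.

Lemma gr_piece_d i : gr_piece 1 (gr_d i).
Proof. by apply/gr_piece_symbol/V_wd. Qed.

Lemma gr_thetaE : gr_theta K n d = \sum_i gr_x i * gr_d i.
Proof.
rewrite /gr_theta (big_ord_narrow le_dn) symbol_sum; last first.
  by move=> i _; exact: (fil_mul (V_wx i) (V_wd i)).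
by apply: eq_bigr => i _; rewrite /gr_x /gr_d symbolM ?V_wx ?V_wd.
Qed.

(** Compared through their values, both index lists are 0, .., d - 1 in increasing order. *)
Lemma gr_xsE : gr_xs K n d = map gr_x (enum 'I_d).
Proof.
rewrite [RHS](map_comp (fun i => symbol F (-1) (wx K i))); congr map.
apply: (inj_map val_inj); rewrite -map_comp.
rewrite (eq_map (g := val)) // val_enum_ord.
rewrite -(filter_map val (fun i => i < d)%N) val_enum_ord.
exact: (filter_iota_ltn 0).
Qed.

(** With [gr_constM] and [gr_const1] this makes [gr_const] a ring morphism; by [gr_const_symbolC]
    its values commute with all symbols. *)
Lemma gr_constD (a b : K) : gr_const n d (a + b) = gr_const n d a + gr_const n d b.
Proof. by rewrite /gr_const scalerDl symbolD ?V_const. Qed.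

Lemma gr_constM (a b : K) : gr_const n d (a * b) = gr_const n d a * gr_const n d b.
Proof. by rewrite /gr_const symbolM ?V_const // mulr_algl scalerA. Qed.

Lemma gr_const1 : gr_const n d (1 : K) = 1.
Proof. by rewrite /gr_const scale1r symbol1. Qed.

Lemma gr_const_sum (I : finType) (a : I -> K) :
  gr_const n d (\sum_i a i) = \sum_i gr_const n d (a i).
Proof. by rewrite /gr_const scaler_suml symbol_sum // => i _; apply: V_const. Qed.

Lemma gr_const_int (z : int) : gr_const n d (z%:~R : K) = z%:~R.
Proof.
have c0 : gr_const n d (0 : K) = 0 by rewrite /gr_const scale0r symbol0.
have cn (m : nat) : gr_const n d (m%:R : K) = m%:R.
  by elim: m => [|m IH] //; rewrite -!natr1 gr_constD IH gr_const1.
case: z => m; first exact: cn.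
rewrite NegzE !mulrNz -[RHS]add0r; apply/eqP; rewrite eq_sym subr_eq.
by rewrite -[X in _ == _ + X]cn -gr_constD addNr c0.
Qed.

Lemma gr_constX (a : K) m : gr_const n d (a ^+ m) = gr_const n d a ^+ m.
Proof. by elim: m => [|m IH]; rewrite ?gr_const1 // !exprS gr_constM IH. Qed.

Lemma gr_const_symbolC (c : K) k a : a \in F k ->
  symbol F k a * gr_const n d c = gr_const n d c * symbol F k a.
Proof.
by move=> Fa; rewrite !symbolM ?V_const // mulr_algl mulr_algr addrC.
Qed.

Lemma gr_piece_const (c : K) : gr_piece 0 (gr_const n d c).
Proof. by apply/gr_piece_symbol/V_const. Qed.

Lemma gr_const_thetaC (c : K) :
  gr_theta K n d * gr_const n d c = gr_const n d c * gr_theta K n d.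
Proof.
rewrite gr_thetaE mulr_suml mulr_sumr; apply: eq_bigr => i _.
by rewrite -mulrA gr_const_symbolC ?V_wd // mulrA gr_const_symbolC ?V_wx // mulrA.
Qed.

Lemma gr_piece_theta : gr_piece 0 (gr_theta K n d).
Proof.
rewrite gr_thetaE; elim/big_ind: _ => [||i _]; first exact: gr_piece0.
  exact: gr_pieceD.
exact: (gr_pieceM (gr_piece_x i) (gr_piece_d i)).
Qed.

Lemma gr_piece_horner (b : {poly K}) (g : gr F) :
  gr_piece 0 g -> gr_piece 0 (gr_horner b g).
Proof.
move=> Pg; rewrite /gr_horner; elim/big_ind: _ => [||i _]; first exact: gr_piece0.
  exact: gr_pieceD.
exact: (gr_pieceM (gr_piece_const _) (gr_pieceX0 i Pg)).
Qed.

Lemma gr_hornerC (b : {poly K}) (g : gr F) c :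
  (forall a, g * gr_const n d a = gr_const n d a * g) ->
  gr_horner b g * gr_const n d c = gr_const n d c * gr_horner b g.
Proof.
move=> Cg; rewrite /gr_horner mulr_suml mulr_sumr; apply: eq_bigr => i _.
rewrite -mulrA -commrX; last by rewrite /GRing.comm Cg.
by rewrite !mulrA -!gr_constM mulrC.
Qed.

(** Once the homotopy has replaced theta + j by the integer [k], this identifies the resulting
    scalar as the class of b(k), which is invertible. *)
Lemma gr_horner_const (b : {poly K}) (z : int) :
  gr_horner b (z%:~R : gr F) = gr_const n d b.[z%:~R].
Proof.
rewrite horner_coef gr_const_sum; apply: eq_bigr => i _.
by rewrite gr_constM gr_constX gr_const_int.
Qed.

(** The coefficients commute with [gr_x i], and powers of [g] inherit the intertwining. *)
Lemma gr_horner_intertwines (b : {poly K}) g i :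
  intertwines g (gr_x i) -> intertwines (fun j => gr_horner b (g j)) (gr_x i).
Proof.
move=> gi j; rewrite /gr_horner mulr_suml mulr_sumr; apply: eq_bigr => l _.
rewrite mulrA gr_const_symbolC ?V_wx // -mulrA.
by rewrite (intertwinesX l gi) mulrA.
Qed.

End WeylSymbols.

(** * Comparison of b(Theta) with b(k) on cohomology *)

Theorem theorem4p2 (R : realType) (n d : nat) (d_gt0 : (1 <= d)%N)
    (d_le_n : (d <= n)%N)
    (L : graded_complex (V_filtration R[i] n d))
    (b : {poly R[i]})
    (b_ann : forall (i j : int) (u : cterm L (i - 1)),
       cpiece j u -> cdiff L i u = 0 ->
       exists2 v : cterm L (i - 1 - 1), cpiece j v &
         cdiff L (i - 1) v = gr_horner b (gr_theta R[i] n d + j%:~R) *: u)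
    (k : int) (bk_neq0 : b.[k%:~R] != 0) :
  koszul_exact L (gr_xs R[i] n d) k.
Proof.
rewrite /koszul_exact (gr_xsE _ d_le_n) -map_rev.
set s := rev _; set X := @gr_x R[i] n d d_le_n.
have us : uniq s by rewrite rev_uniq enum_uniq.
have XX : {in map X s &, forall x y, x * y = y * x}.
  by move=> _ _ /mapP [i _ ->] /mapP [j _ ->]; apply: gr_xC.
move=> m u ku; split=> [du|[v _ <-]]; last exact: kdiff_kdiff.
pose T j := gr_theta R[i] n d + j%:~R.
pose G j := gr_horner b (T j); pose c a := gr_const n d (a : R[i]).
(* The list [s] is reversed to match [koszul_exact]; the sum defining theta does not depend on the
   order. *)
have TE j : T j = \sum_(i <- s) X i * gr_d R[i] d_le_n i + j%:~R.
  rewrite /T (gr_thetaE _ d_le_n); congr (_ + _).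
  by rewrite [RHS](perm_big (enum 'I_d)) ?big_enum //= /s perm_rev.
have XT x : x \in map X s -> intertwines T x.
  move=> /mapP [i si ->] j; rewrite !TE.
  apply: (intertwines_theta (@gr_dx _ _ _ d_le_n)) => // l p _ _.
  exact: gr_xC.
have PT j : gr_piece 0 (T j).
  by apply: gr_pieceD; [exact: gr_piece_theta | exact: gr_piece_int].
have XG x : x \in map X s -> intertwines G x.
  move=> sx; move: (XT x sx); case/mapP: sx => i _ ->.
  exact: gr_horner_intertwines.
have PG j : gr_piece 0 (G j) by apply: gr_piece_horner.
have Xc x a : x \in map X s -> x * c a = c a * x.
  by move=> /mapP [i _ ->]; apply: gr_const_symbolC; apply: V_wx.
have Tc j a : T j * c a = c a * T j.
  by rewrite mulrDl mulrDr gr_const_thetaC // commr_int.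
have Tk : kboundary k (kact T k u - k%:~R *: u).
  rewrite (eq_kact _ _ TE); apply: kboundary_theta => //.
    exact: gr_dx.
  exact: gr_piece_d.
(* The congruence of Theta with [k] passes to b(Theta) and b(k) monomial by monomial, through the
   differences of l-th powers. *)
have Gk : kboundary k (kact G k u - c b.[k%:~R] *: u).
  rewrite /c -gr_horner_const /G /gr_horner kact_suml scaler_suml -sumrB.
  elim/big_ind: _ => [|v w|l _]; first exact: kboundary0.
    exact: kboundaryD.
  rewrite kactM kact_const -scalerA -scalerBr.
  apply: kboundaryZ; [by move=> x sx; apply: Xc|exact: gr_piece_const|].
  apply: kboundary_kactX => //; first by move=> x _; rewrite commr_int.
    exact: gr_piece_int.
  by move=> j; rewrite commr_int.
have [|N /(_ k m u ku du) GN] := kact_annihilates b_ann _ XX XG PG.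
  by move=> x /mapP [i _ ->]; apply: gr_piece_x.
(* Two boundaries are subtracted: b(Theta)^N u by annihilation, and b(Theta)^N u - b(k)^N u by
   congruence. *)
have cN : kboundary k (c b.[k%:~R] ^+ N *: u).
  rewrite -[X in kboundary k X](subKr (kact (fun j => G j ^+ N) k u)).
  apply: kboundaryB => //; apply: kboundary_kactX => //.
  - by move=> x sx; apply: Xc.
  - exact: gr_piece_const.
  by move=> j; apply: gr_hornerC => a; apply: Tc.
suff: kboundary k u by [].
(* Multiplication by the constant inverse to b(k)^N preserves boundaries and recovers [u]. *)
rewrite -[u]scale1r -(gr_const1 R[i] n d) -(mulVf (expf_neq0 N bk_neq0)).
rewrite gr_constM gr_constX -scalerA; apply: kboundaryZ => //.
  by move=> x sx; apply: Xc.
exact: gr_piece_const.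
Qed.
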